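(* Let $N\in\mathbb{N}$. (i) For any $k\in\mathbb{Z}_+$ and $s\in\mathbb{R}$, $$\gamma_N^{s,k}=k!\sum_{l=0}^{\lfloor k/2\rfloor}(k-2l)!\,l!\,\Bigl(\frac{N-3}{2}+l\Bigr)_l\Bigl(\sum_{n=\lceil k/2\rceil}^{k-l}2^{2n-k+l}\binom{s/2}{n}\binom{n}{k-n}\binom{k-n}{l}\Bigr)^2.$$ (ii) For any $k\in\mathbb{N}$, $$\ell_N^k=k!\sum_{l=0}^{\lfloor k/2\rfloor}(k-2l)!\,l!\,\Bigl(\frac{N-3}{2}+l\Bigr)_l\Bigl(\sum_{n=\lceil k/2\rceil}^{k-l}2^{2n-k+l}\frac{(-1)^n}{2n}\binom{n}{k-n}\binom{k-n}{l}\Bigr)^2.$$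
   Context: $|x|_N$ is the Euclidean norm on $\mathbb{R}^N$, $\log$ the natural logarithm, $I_N=\{1,\ldots,N\}$, $D_i=\partial_{x_{i_1}}\cdots\partial_{x_{i_k}}$ for $i=(i_1,\ldots,i_k)\in I_N^k$, and $|\nabla_N^k u(x)|_{N^k}=\bigl(\sum_{i\in I_N^k}(D_iu(x))^2\bigr)^{1/2}$ (for $k=0$ this is $|u(x)|$). It is known that for $k\in\mathbb{Z}_+$, $s\in\mathbb{R}$ the function $x\mapsto(|x|_N^{k-s}|\nabla_N^k[|x|_N^s]|_{N^k})^2$ is constant on $\mathbb{R}^N\setminus\{0\}$; its value is denoted $\gamma_N^{s,k}$. Likewise for $k\in\mathbb{N}$ the function $x\mapsto(|x|_N^{k}|\nabla_N^k[\log|x|_N]|_{N^k})^2$ is constant on $\mathbb{R}^N\setminus\{0\}$, with value $\ell_N^k$. Notation: $(\nu)_k=\prod_{j=0}^{k-1}(\nu-j)$ for $k\in\mathbb{N}$, $(\nu)_0=1$; $\binom{\nu}{k}=(\nu)_k/k!$ for $\nu\in\mathbb{R}$, $k\in\mathbb{Z}_+$; $\lfloor\cdot\rfloor,\lceil\cdot\rceil$ are floor and ceiling. *)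

(* Defs.v *)
From HB Require Import structures.
From mathcomp Require Import all_boot all_order all_algebra.
From mathcomp Require Import all_classical all_reals all_analysis.
Set Implicit Arguments. Unset Strict Implicit. Unset Printing Implicit Defensive.
Import Order.TTheory GRing.Theory Num.Theory.
Import numFieldNormedType.Exports.
Local Open Scope ring_scope.

Section Defs.
Variable R : realType.

Definition enorm (N : nat) (x : 'rV[R]_N) : R :=
  Num.sqrt (\sum_(i < N) (x ord0 i) ^+ 2).

Definition evec (N : nat) (i : 'I_N) : 'rV[R]_N := \row_(j < N) (i == j)%:R.

Definition partial (N : nat) (i : 'I_N) (f : 'rV[R]_N -> R) : 'rV[R]_N -> R :=
  fun x => derive f x (evec i).

Fixpoint pdiff (N : nat) (js : seq 'I_N) (f : 'rV[R]_N -> R) : 'rV[R]_N -> R :=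
  match js with
  | [::] => f
  | i :: js' => partial i (pdiff js' f)
  end.

Definition gradk_norm (N k : nat) (f : 'rV[R]_N -> R) (x : 'rV[R]_N) : R :=
  Num.sqrt (\sum_(t : k.-tuple 'I_N) (pdiff t f x) ^+ 2).

Definition gamma_fun (N : nat) (s : R) (k : nat) (x : 'rV[R]_N) : R :=
  (powR (enorm x) (k%:R - s) * gradk_norm k (fun y => powR (enorm y) s) x) ^+ 2.

Definition ell_fun (N : nat) (k : nat) (x : 'rV[R]_N) : R :=
  ((enorm x) ^+ k * gradk_norm k (fun y => ln (enorm y)) x) ^+ 2.

Definition ffact (nu : R) (k : nat) : R := \prod_(j < k) (nu - j%:R).
Definition rbinom (nu : R) (k : nat) : R := ffact nu k / (k`!)%:R.

Definition gamma_formula (N : nat) (s : R) (k : nat) : R :=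
  (k`!)%:R * \sum_(0 <= l < k./2.+1)
     ((k - 2 * l)`!)%:R * (l`!)%:R * ffact ((N%:R - 3) / 2 + l%:R) l *
     (\sum_(uphalf k <= n < (k - l).+1)
        (2 ^ (2 * n + l - k))%:R * rbinom (s / 2) n
          * rbinom n%:R (k - n) * rbinom (k - n)%:R l) ^+ 2.

Definition ell_formula (N : nat) (k : nat) : R :=
  (k`!)%:R * \sum_(0 <= l < k./2.+1)
     ((k - 2 * l)`!)%:R * (l`!)%:R * ffact ((N%:R - 3) / 2 + l%:R) l *
     (\sum_(uphalf k <= n < (k - l).+1)
        (2 ^ (2 * n + l - k))%:R * ((-1) ^+ n / (2 * n)%:R)
          * rbinom n%:R (k - n) * rbinom (k - n)%:R l) ^+ 2.

End Defs.

(* Main.v *)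
(** For a symmetric k-tensor, the sum of the squared entries is [k!] times the
    Fischer (Bombieri) norm of the associated homogeneous polynomial, for which
    multiplication by the coordinate [y_i] is adjoint to [d/dy_i]. For
    [f = phi(|.|^2)] this polynomial is the degree-k part of the expansion of
    [f(x + y)] in powers of [|x + y|^2 - |x|^2 = 2 r tau + tau^2 + sigma], where
    [r = |x|], [tau = <x, y> / r] and [sigma = |y|^2 - tau^2]. The monomials
    [tau^a sigma^l] are pairwise orthogonal, with norms obtained from the adjoints
    of multiplication by [tau] and [sigma], namely the derivative along [x / r] and
    the Laplacian of the hyperplane orthogonal to [x]. *)
Require Import Defs.
From HB Require Import structures.
From mathcomp Require Import all_boot all_order all_algebra.
From mathcomp Require Import all_classical all_reals all_analysis.
From mathcomp Require Import ring zify.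
From mathcomp Require mpoly.
(* The notations of mpoly clash with those of mathcomp-analysis. *)
Import -(notations) mpoly.
Import Order.TTheory GRing.Theory Num.Theory.
Import numFieldNormedType.Exports.
Local Open Scope ring_scope.

(** * Reindexing of finite sums *)

Lemma sum_tuple_cons (V : nmodType) (T : finType) k (F : seq T -> V) :
  \sum_(t : k.+1.-tuple T) F t = \sum_i \sum_(t : k.-tuple T) F (i :: t).
Proof.
rewrite pair_big /=.
rewrite (reindex (fun p : T * k.-tuple T => cons_tuple p.1 p.2)) //=.
exists (fun t : k.+1.-tuple T => (thead t, [tuple of behead t])) => [[i t] _|t _] /=.
  by congr pair; apply/val_inj.
by apply/val_inj => /=; case/tupleP: t.
Qed.

Lemma sum_pair (V : nmodType) (I J : finType) (F : I * J -> V) :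
  \sum_p F p = \sum_i \sum_j F (i, j).
Proof. by rewrite pair_bigA; apply: eq_bigr => -[]. Qed.

(** * The Fischer pairing on a commutative algebra with commuting derivations *)

Section FischerPairing.
Variables (R : numFieldType) (A : comAlgType R) (N : nat).
Variables (D : 'I_N -> {linear A -> A}) (e : {rmorphism A -> R}) (y : 'I_N -> A).
Hypothesis eZ : forall c f, e (c *: f) = c * e f.
Hypothesis DM : forall i (f g : A), D i (f * g) = D i f * g + f * D i g.
Hypothesis DC : forall i j f, D i (D j f) = D j (D i f).
Hypothesis ey : forall i, e (y i) = 0.
Hypothesis Dy : forall i j, D i (y j) = (i == j)%:R.

(** [e] plays the role of evaluation at the common zero of the [y i]. For polynomials, the pairing
    of order [k] therefore sees only the parts of degree [k] in [y], and nothing has to be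
    truncated. *)
Fixpoint pairing (k : nat) (f g : A) : R :=
  if k is k'.+1 then \sum_i pairing k' (D i f) (D i g) else e f * e g.

Lemma pairingS k f g : pairing k.+1 f g = \sum_i pairing k (D i f) (D i g).
Proof. by []. Qed.

Lemma pairing0E f g : pairing 0 f g = e f * e g.
Proof. by []. Qed.

Arguments pairing : simpl never.

Lemma der_one i : D i 1 = 0.
Proof.
have := DM i 1 1; rewrite mulr1 mulr1 mul1r => /eqP.
by rewrite -subr_eq0 opprD addrA subrr sub0r oppr_eq0 => /eqP.
Qed.

(** The recursion applies the first letter of a word innermost, [foldr] applies it outermost;
    commutation of the [D i] reconciles the two. *)
Lemma pairing_tuple k f g :
  pairing k f g = \sum_(t : k.-tuple 'I_N) e (foldr D f t) * e (foldr D g t).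
Proof.
have Dfold i t h : D i (foldr D h t) = foldr D (D i h) t.
  by elim: t => //= j t <-; rewrite DC.
elim: k f g => [|k IH] f g.
  rewrite pairing0E (big_pred1 [tuple]) // => t.
  by rewrite [t]tuple0; apply/esym/eqP/val_inj.
rewrite pairingS (sum_tuple_cons _ _ k (fun t => e (foldr D f t) * e (foldr D g t))).
apply: eq_bigr => i _; rewrite IH; apply: eq_bigr => t _ /=.
by rewrite !Dfold.
Qed.

Lemma pairing_linearl k g c f1 f2 :
  pairing k (c *: f1 + f2) g = c * pairing k f1 g + pairing k f2 g.
Proof.
elim: k f1 f2 g => [|k IH] f1 f2 g; first by rewrite !pairing0E rmorphD eZ /= mulrDl mulrA.
by rewrite !pairingS mulr_sumr -big_split; apply: eq_bigr => i _; rewrite linearP IH.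
Qed.

Lemma pairingC k f g : pairing k f g = pairing k g f.
Proof.
elim: k f g => [|k IH] f g; first by rewrite !pairing0E mulrC.
by rewrite !pairingS; apply: eq_bigr => i _; rewrite IH.
Qed.

Lemma pairingDl k g f1 f2 : pairing k (f1 + f2) g = pairing k f1 g + pairing k f2 g.
Proof. by have := pairing_linearl k g 1 f1 f2; rewrite scale1r mul1r. Qed.

Lemma pairing0l k g : pairing k 0 g = 0.
Proof. by apply: (addrI (pairing k 0 g)); rewrite -pairingDl !addr0. Qed.

Lemma pairingZl k g c f : pairing k (c *: f) g = c * pairing k f g.
Proof. by have := pairing_linearl k g c f 0; rewrite pairing0l !addr0. Qed.

Lemma pairingBl k g f1 f2 : pairing k (f1 - f2) g = pairing k f1 g - pairing k f2 g.
Proof. by rewrite pairingDl -scaleN1r pairingZl mulN1r. Qed.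

Lemma pairingBr k f g1 g2 : pairing k f (g1 - g2) = pairing k f g1 - pairing k f g2.
Proof. by rewrite pairingC pairingBl !(pairingC k f). Qed.

Lemma pairing_suml k g (I : finType) (F : I -> A) :
  pairing k (\sum_i F i) g = \sum_i pairing k (F i) g.
Proof.
by apply: (big_morph (pairing k ^~ g)) => [f1 f2|]; rewrite (pairingDl, pairing0l).
Qed.

Lemma pairing_sumr k f (I : finType) (F : I -> A) :
  pairing k f (\sum_i F i) = \sum_i pairing k f (F i).
Proof. by rewrite pairingC pairing_suml; apply: eq_bigr => i _; rewrite pairingC. Qed.

Lemma pairingZr k f c g : pairing k f (c *: g) = c * pairing k f g.
Proof. by rewrite pairingC pairingZl pairingC. Qed.

(** The product rule for [D j (y i * f)] leaves [y i * D j f], handled by induction, and for [j = i]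
    an extra [f] that raises the numerical factor by one. *)
Lemma pairing_mulyl k i f g :
  pairing k.+1 (y i * f) g = k.+1%:R * pairing k f (D i g).
Proof.
elim: k f g => [|k IH] f g.
  rewrite mul1r pairingS (bigD1 i) //= big1 ?addr0 => [|j ji].
    by rewrite DM Dy eqxx mul1r !pairing0E rmorphD rmorphM /= ey mul0r addr0.
  by rewrite DM Dy (negPf ji) mul0r add0r pairing0E rmorphM /= ey !mul0r.
rewrite pairingS; under eq_bigr => j _ do rewrite DM Dy pairingDl IH DC.
rewrite big_split -mulr_sumr -pairingS -[k.+2%:R]natr1 [RHS]mulrDl mul1r addrC.
congr (_ + _); rewrite (bigD1 i) //= eqxx mul1r big1 ?addr0 // => j ji.
by rewrite (negPf ji) mul0r pairing0l.
Qed.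

(** * Splitting along a unit vector: the monomials in [tau] and [sigma] *)

Variable u : 'I_N -> R.
Hypothesis u1 : \sum_i u i ^+ 2 = 1.

Definition tau : A := \sum_i u i *: y i.
Definition sigma : A := \sum_i y i ^+ 2 - tau ^+ 2.
Definition Du (g : A) : A := \sum_i u i *: D i g.
Definition Lap (g : A) : A := \sum_i D i (D i g) - Du (Du g).

Lemma pairing_taul k f g : pairing k.+1 (tau * f) g = k.+1%:R * pairing k f (Du g).
Proof.
rewrite /tau mulr_suml pairing_suml /Du pairing_sumr mulr_sumr.
apply: eq_bigr => i _.
by rewrite -scalerAl pairingZl pairing_mulyl pairingZr mulrCA.
Qed.

Lemma pairing_sigmal k f g :
  pairing k.+2 (sigma * f) g = (k.+2 * k.+1)%:R * pairing k f (Lap g).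
Proof.
rewrite /sigma mulrBl pairingBl pairingBr mulrBr natrM; congr (_ - _).
  rewrite mulr_suml pairing_suml pairing_sumr mulr_sumr; apply: eq_bigr => i _.
  by rewrite expr2 -mulrA !pairing_mulyl mulrA.
by rewrite expr2 -mulrA !pairing_taul mulrA.
Qed.

Lemma e_tau : e tau = 0.
Proof. by rewrite raddf_sum big1 // => i _; rewrite /= eZ ey mulr0. Qed.

Lemma e_sigma : e sigma = 0.
Proof.
rewrite rmorphB rmorphXn /= e_tau expr0n subr0 raddf_sum big1 // => i _.
by rewrite /= rmorphXn /= ey expr0n.
Qed.

(** The order not reached by [pairing_sigmal]: [sigma] is quadratic in elements killed by [e], so
    one derivative cannot make it visible. *)
Lemma pairing1_sigmal f g : pairing 1 (sigma * f) g = 0.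
Proof.
rewrite mulrBl pairingBl.
rewrite expr2 -mulrA pairing_taul pairing0E rmorphM e_tau /= !mul0r mulr0 subr0.
rewrite mulr_suml pairing_suml big1 // => i _.
by rewrite expr2 -mulrA pairing_mulyl pairing0E rmorphM /= ey !mul0r mulr0.
Qed.

Lemma DXn i f n : D i (f ^+ n) = f ^+ n.-1 * D i f *+ n.
Proof.
elim: n => [|n IH]; first by rewrite expr0 der_one mulr0n.
rewrite exprS DM IH mulrnAr; case: n {IH} => [|n] /=.
  by rewrite expr0 mulr0n addr0 mulr1 mul1r.
by rewrite mulrA -exprS [D i f * _]mulrC -mulrS.
Qed.

Lemma D_tau i : D i tau = (u i)%:A.
Proof.
rewrite raddf_sum (bigD1 i) //= big1 => [|j ji].
  by rewrite addr0 linearZ /= Dy eqxx.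
by rewrite linearZ /= Dy eq_sym (negPf ji) scaler0.
Qed.

Lemma D_sigma i : D i sigma = (y i - (u i)%:A * tau) *+ 2.
Proof.
rewrite linearB /= DXn D_tau /= expr1 raddf_sum (bigD1 i) //= big1 => [|j ji].
  by rewrite addr0 DXn Dy eqxx mulr1 expr1 mulrnBl mulrC.
by rewrite DXn Dy eq_sym (negPf ji) mulr0 mul0rn.
Qed.

Lemma DuD f g : Du (f + g) = Du f + Du g.
Proof. by rewrite -big_split; apply: eq_bigr => i _; rewrite linearD scalerDr. Qed.

Lemma DuM f g : Du (f * g) = Du f * g + f * Du g.
Proof.
rewrite mulr_suml mulr_sumr -big_split; apply: eq_bigr => i _.
by rewrite DM scalerDr -scalerAl -scalerAr.
Qed.

Lemma DuXn f n : Du (f ^+ n) = f ^+ n.-1 * Du f *+ n.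
Proof.
rewrite mulr_sumr -sumrMnl; apply: eq_bigr => i _.
by rewrite DXn -scalerAr scalerMnr.
Qed.

Lemma sum_uA : \sum_i (u i)%:A * (u i)%:A = 1 :> A.
Proof.
under eq_bigr => i _ do rewrite mulr_algl scalerA -expr2.
by rewrite -scaler_suml u1 scale1r.
Qed.

Lemma tauE : tau = \sum_i (u i)%:A * y i.
Proof. by apply: eq_bigr => i _; rewrite mulr_algl. Qed.

Lemma DuE f : Du f = \sum_i (u i)%:A * D i f.
Proof. by apply: eq_bigr => i _; rewrite mulr_algl. Qed.

Lemma Du_tau : Du tau = 1.
Proof. by rewrite DuE -[RHS]sum_uA; apply: eq_bigr => i _; rewrite D_tau. Qed.

(** Half the gradient of [sigma] is [y] minus its projection on [u], hence orthogonal to the unit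
    vector [u]. *)
Lemma Du_sigma : Du sigma = 0.
Proof.
rewrite DuE; under eq_bigr => i _ do rewrite D_sigma mulrnAr mulrBr mulrA.
by rewrite sumrMnl sumrB -tauE -mulr_suml sum_uA mul1r subrr mul0rn.
Qed.

Lemma Du_mono a l : Du (tau ^+ a * sigma ^+ l) = tau ^+ a.-1 * sigma ^+ l *+ a.
Proof.
by rewrite DuM !DuXn Du_tau Du_sigma !(mulr0, mul0rn) addr0 mulr1 mulrnAl.
Qed.

(* Carre du champ of the operator [Lap]. *)
Definition Gam f g : A := \sum_i D i f * D i g - Du f * Du g.

Lemma LapM f g : Lap (f * g) = Lap f * g + Gam f g *+ 2 + f * Lap g.
Proof.
rewrite /Lap /Gam !DuM !DuD !DuM.
under eq_bigr => i _ do rewrite DM linearD /= !DM.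
rewrite !big_split -mulr_suml -mulr_sumr /=.
by set a := \sum_i _; set b := \sum_i _; set c := \sum_i _; ring.
Qed.

Lemma Gam_sigmaE f : Gam sigma f = \sum_i D i sigma * D i f.
Proof. by rewrite /Gam Du_sigma mul0r subr0. Qed.

Lemma Gam_sigma_tau : Gam sigma tau = 0.
Proof.
rewrite Gam_sigmaE -[RHS]Du_sigma DuE.
by apply: eq_bigr => i _; rewrite D_tau mulrC.
Qed.

(** The gradient of [sigma] is twice the part of [y] orthogonal to [u], whose squared length is
    [sigma]. *)
Lemma Gam_sigma_sigma : Gam sigma sigma = sigma *+ 4.
Proof.
rewrite Gam_sigmaE.
transitivity (\sum_i (y i ^+ 2 *+ 4 - (u i)%:A * y i * tau *+ 8
                + (u i)%:A * (u i)%:A * tau ^+ 2 *+ 4)).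
  by apply: eq_bigr => i _; rewrite D_sigma; ring.
rewrite big_split sumrB !sumrMnl -!mulr_suml sum_uA -tauE /sigma /=.
by set a := \sum_i _; ring.
Qed.

(** [Gam sigma] is a derivation that kills [tau] and multiplies [sigma] by 4. *)
Lemma Gam_sigma_mono a l :
  Gam sigma (tau ^+ a * sigma ^+ l) = tau ^+ a * sigma ^+ l *+ (4 * l).
Proof.
transitivity (tau ^+ a.-1 * sigma ^+ l * Gam sigma tau *+ a +
              tau ^+ a * sigma ^+ l.-1 * Gam sigma sigma *+ l).
  rewrite !Gam_sigmaE !mulr_sumr -!sumrMnl -big_split; apply: eq_bigr => i _ /=.
  by rewrite DM !DXn; ring.
rewrite Gam_sigma_tau Gam_sigma_sigma mulr0 mul0rn add0r.
by case: l => [|l]; rewrite /= ?mulr0n // exprSr; ring.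
Qed.

(** A power of [tau] varies only along [u], so its full Laplacian is its second derivative along
    [u]. *)
Lemma Lap_tauX a : Lap (tau ^+ a) = 0.
Proof.
rewrite /Lap.
have Dt i : D i (tau ^+ a) = (u i)%:A * (tau ^+ a.-1 *+ a).
  by rewrite DXn D_tau mulrnAr mulrC.
have Dut : Du (tau ^+ a) = tau ^+ a.-1 *+ a by rewrite DuXn Du_tau mulr1.
rewrite Dut DuE; apply/eqP; rewrite subr_eq0; apply/eqP/eq_bigr => i _.
by rewrite Dt !mulr_algl linearZ.
Qed.

Lemma Lap_sigma : Lap sigma = (N%:R - 1) *+ 2.
Proof.
rewrite /Lap Du_sigma /Du [X in _ - X]big1 ?subr0; last first.
  by move=> i _; rewrite linear0 scaler0.
under eq_bigr => i _ do
  rewrite D_sigma linearMn linearB /= Dy eqxx mulr_algl linearZ /= D_tau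
    -(mulr_algl (u i) (u i)%:A).
by rewrite sumrMnl sumrB sum_uA sumr_const card_ord.
Qed.

(** This is the Laplacian of a power of the squared norm in dimension [N - 1]. One factor [sigma] is
    split off at a time, and [Gam_sigma_mono] gives the cross term. For [l = 0] the coefficient is
    zero, so the value of [l.-1] is harmless. *)
Lemma Lap_mono a l :
  Lap (tau ^+ a * sigma ^+ l) =
  ((2 * l)%:R * ((2 * l)%:R + N%:R - 3)) *: (tau ^+ a * sigma ^+ l.-1).
Proof.
rewrite -scalerA scalerBl scalerDl !scaler_nat.
elim: l => [|l IH]; first by rewrite mulr1 Lap_tauX muln0 mulr0n.
rewrite exprS mulrCA LapM IH Gam_sigma_mono Lap_sigma.
by case: l {IH} => [|l]; rewrite /= ?exprS; ring.
Qed.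

(** Moving one [tau] across the pairing costs the current degree times the exponent of [tau]; moving
    one [sigma] costs two successive degrees times the coefficient in [Lap_mono]. The degrees
    multiply to the first factorial. *)
Definition mono_norm (a l : nat) : R :=
  (a + 2 * l)`!%:R * a`!%:R * \prod_(j < l) ((2 * j.+1)%:R * ((2 * j.+1)%:R + N%:R - 3)).

(** The factors of the left monomial are moved to the right as [Du] and [Lap], first all [tau], then
    all [sigma]. Each step lowers the matching exponent on the right, so only equal exponents
    survive. *)
Lemma pairing_mono k a l b m :
  pairing k (tau ^+ a * sigma ^+ l) (tau ^+ b * sigma ^+ m) =
  if [&& k == (a + 2 * l)%N, a == b & l == m] then mono_norm a l else 0.
Proof.
elim: a k b => [|a IH] k b; last first.
  rewrite exprS -mulrA; case: k => [|k].
    by rewrite pairing0E rmorphM /= e_tau !mul0r.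
  rewrite pairing_taul Du_mono -[_ *+ b]scaler_nat pairingZr IH addSn eqSS.
  case: b => [|b]; first by rewrite mul0r mulr0 andbF.
  rewrite eqSS /=; case: ifP => [/and3P[/eqP-> /eqP<- _]|_]; last by rewrite !mulr0.
  by rewrite /mono_norm addSn !factS !natrM; ring.
rewrite expr0 mul1r; elim: l k m => [|l IH] k m.
  rewrite expr0 muln0 /mono_norm big_ord0 !mulr1.
  case: k => [|k]; last by rewrite pairingS big1 // => i _; rewrite der_one pairing0l.
  rewrite pairing0E rmorphM !rmorphXn rmorph1 /= e_tau e_sigma mul1r !expr0n.
  by case: b m => [|b] [|m]; rewrite /= ?mulr0 ?mul0r ?mulr1.
rewrite exprS; case: k => [|[|k]].
- by rewrite pairing0E rmorphM /= e_sigma !mul0r.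
- by rewrite pairing1_sigmal mulnS.
rewrite pairing_sigmal Lap_mono pairingZr IH !add0n [(2 * l.+1)%N]mulnS add2n !eqSS.
case: m => [|m]; first by rewrite muln0 !mul0r mulr0 !andbF.
rewrite eqSS /=; case: ifP => [/and3P[/eqP-> _ /eqP<-]|_]; last by rewrite !mulr0.
rewrite /mono_norm big_ord_recr /= !add0n [(2 * l.+1)%N]mulnS add2n !factS !natrM.
by set p := \prod_(i < l) _; ring.
Qed.

(** By orthogonality only equal monomials interact. In degree [k] the exponent of [sigma] determines
    that of [tau], so the coefficients are grouped by the former. *)
Lemma pairing_comb k (I : finType) (c : I -> R) (a l : I -> nat) :
  let f := \sum_p c p *: (tau ^+ a p * sigma ^+ l p) in
  pairing k f f = \sum_(m < k./2.+1) mono_norm (k - 2 * m) m *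
     (\sum_(p | (a p + 2 * l p == k)%N && (l p == m)) c p) ^+ 2.
Proof.
move=> f; rewrite /f pairing_suml.
under [RHS]eq_bigr => m _ do rewrite expr2 big_distrlr mulr_sumr big_mkcond /=.
rewrite exchange_big; apply: eq_bigr => p _ /=.
rewrite pairingZl pairing_sumr mulr_sumr.
(* For a given pair of indices at most one [m] satisfies the condition, namely the common exponent
   of [sigma]. *)
transitivity (\sum_q \sum_(m < k./2.+1)
   if ((a p + 2 * l p == k)%N && (l p == m)) && ((a q + 2 * l q == k)%N && (l q == m))
   then mono_norm (k - 2 * m) m * (c p * c q) else 0); last first.
  rewrite exchange_big; apply: eq_bigr => m _ /=.
  case: ifP => _; last by rewrite big1.
  by rewrite mulr_sumr -big_mkcond.
apply: eq_bigr => q _; rewrite pairingZr pairing_mono.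
case: ifP => [/and3P[/eqP-> /eqP-> /eqP->]|cond]; last first.
  rewrite !mulr0 big1 // => m _; case: ifP => //
    /andP[/andP[/eqP pk /eqP pm] /andP[/eqP qk /eqP qm]].
  by move/negP: cond; case; apply/and3P; split; apply/eqP; lia.
have lk : (l q < ((a q + 2 * l q)./2).+1)%N.
  by rewrite ltnS mul2n halfD odd_double andbF doubleK leq_addl.
rewrite (bigD1 (Ordinal lk)) //= !eqxx /= big1 ?addr0 ?addnK; first by ring.
by move=> m; rewrite -val_eqE /= eq_sym => /negPf->; rewrite !andbF.
Qed.

(** A range independent of [n] gives nested expansions a fixed index type; the added binomial
    coefficients are zero. *)
Lemma exprDn_widen k n (f g : A) : (n <= k)%N ->
  (f + g) ^+ n = \sum_(i < k.+1) 'C(n, i)%:R *: (f ^+ (n - i) * g ^+ i).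
Proof.
move=> nk; rewrite exprDn (big_ord_widen k.+1 (fun i => f ^+ (n - i) * g ^+ i *+ 'C(n, i))) //.
rewrite big_mkcond; apply: eq_bigr => i _; rewrite scaler_nat.
by case: ltnP => // ni; rewrite bin_small.
Qed.

(** Since the squared norm of [y] is [tau ^+ 2 + sigma], each [Q ^+ n] expands by two binomial
    formulas. A term with [j] quadratic factors has degree [n + j], so order [k] selects [j = k - n]
    and the triple sum collapses. *)
Lemma pairing_radial k (r : R) (c : nat -> R) :
  let Q := r *: tau + 2^-1 *: \sum_i y i ^+ 2 in
  let f := \sum_(n < k.+1) c n *: Q ^+ n in
  pairing k f f = \sum_(l < k./2.+1) mono_norm (k - 2 * l) l *
    (\sum_(n < k.+1) c n * 'C(n, k - n)%:R * 'C(k - n, l)%:R *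
       2^-1 ^+ (k - n) * r ^+ (n - (k - n))) ^+ 2.
Proof.
move=> Q f.
(* In the term indexed by [n], [j], [l], the quadratic part is taken from [j] of the [n] factors
   [Q], and [sigma] from [l] of those [j]. *)
pose co (p : 'I_k.+1 * ('I_k.+1 * 'I_k.+1)) : R := let: (n, (j, l)) := p in
  c n * 'C(n, j)%:R * 'C(j, l)%:R * 2^-1 ^+ j * r ^+ (n - j).
pose a (p : 'I_k.+1 * ('I_k.+1 * 'I_k.+1)) : nat := let: (n, (j, l)) := p in
  ((n - j) + 2 * (j - l))%N.
have -> : f = \sum_p co p *: (tau ^+ a p * sigma ^+ (p.2.2)).
  rewrite sum_pair; apply: eq_bigr => n _ /=; rewrite /Q (@exprDn_widen k) -1?ltnS //.
  rewrite sum_pair scaler_sumr; apply: eq_bigr => j _ /=.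
  have -> : \sum_i y i ^+ 2 = tau ^+ 2 + sigma by rewrite /sigma addrC subrK.
  rewrite [(2^-1 *: _) ^+ _]exprZn (@exprDn_widen k) -1?ltnS // exprZn.
  rewrite !(scaler_sumr, mulr_sumr); apply: eq_bigr => l _.
  rewrite exprD exprM; move: (tau ^+ _) (tau ^+ _ ^+ _) (sigma ^+ _) => f1 f2 f3.
  rewrite -scalerAl -!scalerAr !scalerA mulrA.
  by congr (_ *: _); ring.
rewrite pairing_comb; apply: eq_bigr => -[l lk] _ /=; congr (_ * _ ^+ 2).
rewrite big_mkcond sum_pair; apply: eq_bigr => n _; rewrite sum_pair /=.
have nk : (k - n < k.+1)%N by rewrite ltnS leq_subr.
have lk1 : (l < k.+1)%N by move: lk; lia.
rewrite (bigD1 (Ordinal nk)) //= [X in _ + X]big1 ?addr0 => [|j jk]; last first.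
  rewrite big1 // => m _; case: ifP => // /andP[/eqP E _].
  case: (ltnP n j) => [nj|jn]; first by rewrite bin_small // mulr0 !mul0r.
  case: (ltnP j m) => [jm|mj]; first by rewrite (bin_small jm) mulr0 !mul0r.
  by move: jk; rewrite -val_eqE /= => /eqP []; lia.
rewrite (bigD1 (Ordinal lk1)) //= [X in _ + X]big1 ?addr0 => [|m]; last first.
  by rewrite -val_eqE /= => /negPf->; rewrite andbF.
(* With [j = k - n] the degree condition can fail only through truncated subtraction, and then one
   of the binomials is zero. *)
rewrite eqxx andbT; case: ifP => // /negP E.
case: (ltnP n (k - n)) => [nj|jn]; first by rewrite bin_small // mulr0 !mul0r.
case: (ltnP (k - n) l) => [jm|mj]; first by rewrite (bin_small jm) mulr0 !mul0r.
case: E; have := ltn_ord n; lia.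
Qed.

End FischerPairing.

(** * Partial derivatives of functions of the squared norm *)

Section Analysis.
Variables (R : realType) (N : nat).
Implicit Types (x z v : 'rV[R]_N).

(** The two difference quotients coincide, so directional derivatives follow from one-variable
    calculus along a line. *)
Lemma is_derive_lineP (f : 'rV[R]_N -> R) x v df :
  is_derive (0 : R) (1 : R) (fun h : R => f (h *: v + x)) df -> is_derive x v f df.
Proof.
have E : (fun h : R => h^-1 *: ((f \o shift x) (h *: v) - f x)) =
         (fun h : R => h^-1 *: (((fun h : R => f (h *: v + x)) \o shift 0) (h *: 1) -
                                f (0 *: v + x))).
  by apply/funext => h /=; rewrite addr0 scale0r add0r [h *: 1]mulr1.
case=> dg dgE; split; first by rewrite /derivable E.
by rewrite -dgE /derive E.
Qed.

Lemma is_derive_coord x i j :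
  is_derive x (evec R i) (fun z => z ord0 j) (i == j)%:R.
Proof.
apply: is_derive_lineP.
have -> : (fun h : R => (h *: evec R i + x) ord0 j) =
          (fun h => h * (i == j)%:R + x ord0 j).
  by apply/funext => h; rewrite !mxE.
have := is_deriveD (is_deriveZ (i == j)%:R (is_derive_id (0 : R) (1 : R)))
   (is_derive_cst (x ord0 j) (0 : R) (1 : R)).
rewrite addr0 [_ *: 1]mulr1; congr is_derive.
by apply/funext => h /=; rewrite fctE mulrC.
Qed.

Definition sqn z : R := \sum_(j < N) z ord0 j ^+ 2.

Lemma is_derive_sqn x i (phi : R -> R) d :
  is_derive (sqn x) 1 phi d ->
  is_derive x (evec R i) (phi \o sqn) (x ord0 i *+ 2 * d).
Proof.
move=> dphi; apply: is_derive_lineP.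
have dq : is_derive (0 : R) 1 (fun h : R => sqn (h *: evec R i + x)) (x ord0 i *+ 2).
  have -> : (fun h : R => sqn (h *: evec R i + x)) =
            (id ^+ 2 + (x ord0 i *+ 2) \*: id + cst (sqn x) :> (R -> R)).
    apply/funext => h /=; rewrite !fctE /sqn.
    transitivity (\sum_(j < N) ((i == j)%:R * h ^+ 2 +
        (i == j)%:R * (x ord0 i *+ 2 * h)  + x ord0 j ^+ 2)).
      apply: eq_bigr => j _; rewrite !mxE; case: eqP => [->|_] /=; ring.
    rewrite !big_split /= (bigD1 i) //= eqxx big1 => [|j ji]; last first.
      by rewrite eq_sym (negPf ji) mul0r.
    rewrite (bigD1 i) //= eqxx big1 => [|j ji]; last first.
      by rewrite eq_sym (negPf ji) mul0r.
    by rewrite !addr0 !mul1r.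
  apply: is_derive_eq.
  by rewrite /= mulr0 !scale0r add0r addr0 [_ *: 1]mulr1.
have dphi' : is_derive (sqn ((0:R) *: evec R i + x)) (1:R) phi d.
  by rewrite scale0r add0r.
have := @is_derive1_comp _ phi _ _ _ _ dphi' dq.
by rewrite mulrC.
Qed.

Lemma sqn_gt0 z : z != 0 -> 0 < sqn z.
Proof.
move=> z0; rewrite lt_neqAle sumr_ge0 ?andbT => [|j _]; last exact: sqr_ge0.
apply: contraNneq z0 => /esym/eqP; rewrite psumr_eq0 => [|j _]; last exact: sqr_ge0.
move/allP => z0; apply/eqP/rowP => j; rewrite mxE.
by apply/eqP; rewrite -sqrf_eq0; apply: z0; rewrite mem_index_enum.
Qed.

Lemma near_neq0 x : x != 0 -> \forall z \near x, z != 0.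
Proof.
move=> x0.
apply: open_nbhs_nbhs; split => //.
have -> : (fun z => is_true (z != 0)) = (~` [set 0 : 'rV[R]_N])%classic.
  by apply/funext => z; apply/propext; split => [/eqP|/eqP].
by apply/closed_openC/accessible_closed_set1/hausdorff_accessible/norm_hausdorff.
Qed.

Definition mev z (p : mpoly N R) : R := meval (fun i => z ord0 i) p.

Lemma mderivXU i j : mderiv i (mpolyX R (mnm1 j)) = (i == j)%:R :> mpoly N R.
Proof.
rewrite mderivX mnm1E eq_sym; case: eqP => [->|_]; last by rewrite scale0r.
rewrite scale1r (_ : mnm_sub (mnm1 j) (mnm1 j) = @mnm0 N) ?mpolyX0 //.
by apply/mnmP => l; rewrite !mnmE subnn.
Qed.

(** Constants and variables satisfy this, and the property passes to products and sums, hence to all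
    polynomials. *)
Lemma is_derive_mev z i p : is_derive z (evec R i) (mev ^~ p) (mev z (mderiv i p)).
Proof.
pose der p := is_derive z (evec R i) (mev ^~ p) (mev z (mderiv i p)).
have derM q r : der q -> der r -> der (q * r).
  move=> dq dr; have := is_deriveM dq dr; rewrite /der.
  have -> : mev^~ (q * r) = (mev^~ q * mev^~ r :> ('rV[R]_N -> R)).
    by apply/funext => y; rewrite /mev mevalM fctE.
  by rewrite mderivM /mev mevalD !mevalM addrC [X in X + _]mulrC.
have derC c : der (mpolyC N c).
  rewrite /der mderivC /mev meval0.
  have -> : (fun y => mev y (mpolyC N c)) = cst c.
    by apply/funext => y; rewrite /mev mevalC.
  exact: is_derive_cst.
have derX j : der (mpolyX R (mnm1 j)).
  rewrite /der.
  have -> : (fun y => mev y (mpolyX R (mnm1 j))) = (fun y => y ord0 j).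
    by apply/funext => y; rewrite /mev mevalXU.
  have -> : mev z (mderiv i (mpolyX R (mnm1 j))) = (i == j)%:R.
    by rewrite mderivXU /mev rmorph_nat.
  exact: is_derive_coord.
elim/mpolyind: p => [|c m p _ _ IH]; first by have := derC 0; rewrite mpolyC0.
have : der (c *: mpolyX R m).
  rewrite -mul_mpolyC; apply: (derM) => //.
  rewrite mpolyXE_id; elim/big_rec: _ => [|j q _ dq].
    by have := derC 1; rewrite mpolyC1.
  apply: (derM) dq; elim: (m j) => [|n IHn].
    by rewrite expr0; have := derC 1; rewrite mpolyC1.
  by rewrite exprS; apply: derM.
move=> d1; have := is_deriveD d1 IH; rewrite /der mderivD /mev mevalD.
by congr is_derive; apply/funext => y; rewrite /mev mevalD fctE.
Qed.

(* [jetpoly w n] is the coefficient of [T^n] in [exp(-T q) D_w exp(T q)], with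
   [q = |X|^2 / 2]: the universal polynomials of the iterated chain rule for
   functions of [q]. *)
Fixpoint jetpoly (w : seq 'I_N) (n : nat) : mpoly N R :=
  if w is i :: w' then
    mderiv i (jetpoly w' n) +
    (if n is m.+1 then mpolyX R (mnm1 i) * jetpoly w' m else 0)
  else (n == 0)%:R.

(** Each letter raises the degree in [T] by at most one. *)
Lemma jetpoly_oversize w n : (size w < n)%N -> jetpoly w n = 0.
Proof.
elim: w n => [|i w IH] [|n] //= wn.
by rewrite !IH ?mderiv0 ?mulr0 ?addr0 // ltnW.
Qed.

(** The hypothesis makes [g n] the [n]-th derivative of [g 0] with respect to half the squared norm.
    The product rule then gives the two terms of the recursion for [jetpoly]. *)
Lemma pdiff_jetpoly (g : nat -> 'rV[R]_N -> R) :
  (forall n z i, z != 0 -> is_derive z (evec R i) (g n) (z ord0 i * g n.+1 z)) ->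
  forall w z, z != 0 ->
  pdiff w (g 0) z = \sum_(n < (size w).+1) g n z * mev z (jetpoly w n).
Proof.
move=> dg; elim=> [|i w IH] z z0.
  by rewrite big_ord1 /= /mev meval1 mulr1.
have dsum : is_derive z (evec R i)
    (\sum_(n < (size w).+1) (g n * mev ^~ (jetpoly w n)))
    (\sum_(n < (size w).+1) (g n z * mev z (mderiv i (jetpoly w n)) +
       mev z (jetpoly w n) * (z ord0 i * g n.+1 z))).
  apply: is_derive_sum => n.
  by have := is_deriveM (dg n z i z0) (is_derive_mev z i (jetpoly w n)).
rewrite [LHS](_ : _ = \sum_(n < (size w).+1) (g n z * mev z (mderiv i (jetpoly w n)) +
    mev z (jetpoly w n) * (z ord0 i * g n.+1 z))); last first.
  rewrite -[LHS]/(derive (pdiff w (g 0)) z (evec R i)); apply: derive_val.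
  (* The induction hypothesis holds only off the origin, which still covers a neighbourhood of
     [z]. *)
  apply: near_eq_is_derive dsum.
  near=> y; rewrite IH; last by near: y; exact: near_neq0.
  by rewrite fct_sumE; apply: eq_bigr => n _.
rewrite /= big_split [in RHS]/=.
under [RHS]eq_bigr => n _ do rewrite /mev mevalD mulrDr.
rewrite big_split; congr (_ + _).
  rewrite [RHS]big_ord_recr /= (@jetpoly_oversize w _.+1) //.
  by rewrite mderiv0 meval0 mulr0 addr0.
rewrite [RHS]big_ord_recl /= meval0 mulr0 add0r; apply: eq_bigr => n _ /=.
by rewrite mevalM mevalXU /mev; ring.
Unshelve. all: by end_near.
Qed.

(** The formal counterpart of [pdiff_jetpoly]: the [m]-th derivative of [Q ^+ n] in [Q] takes the
    place of [g m]. Only the gradient of [Q] matters, so an additive constant in [Q] stays free. *)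
Lemma foldr_mderivX (Q : mpoly N R) n w :
  (forall i, mderiv i Q = mpolyX R (mnm1 i)) ->
  foldr (@mderiv N R) (Q ^+ n) w =
  \sum_(m < (size w).+1) Q ^+ (n - m) * jetpoly w m *+ n ^_ m.
Proof.
move=> dQ.
have dX i m : mderiv i (Q ^+ m) = Q ^+ m.-1 * mpolyX R (mnm1 i) *+ m.
  rewrite -dQ; elim: m => [|m IH].
    by rewrite expr0 mulr0n -mpolyC1 mderivC.
  rewrite exprS mderivM IH mulrnAr; case: m {IH} => [|m] /=.
    by rewrite expr0 mulr0n addr0 mulr1 mul1r.
  by rewrite mulrA -exprS [mderiv i Q * _]mulrC -mulrS.
elim: w => [|i w IH] /=; first by rewrite big_ord1 subn0 ffactn0 mulr1.
rewrite IH raddf_sum /=.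
under eq_bigr => m _ do rewrite mderivMn mderivM dX mulrnDl addrC.
under [RHS]eq_bigr => m _ do rewrite mulrDr mulrnDl.
rewrite !big_split; congr (_ + _).
  by rewrite [RHS]big_ord_recr /= jetpoly_oversize // mderiv0 mulr0 mul0rn addr0.
rewrite [RHS]big_ord_recl /= mulr0 mul0rn add0r; apply: eq_bigr => m _ /=.
rewrite /bump /= add1n ffactnSr subnS mulnC mulrnA !mulrA.
by rewrite mulrnAl.
Qed.

(* Hence the derivatives of any function of [q] at [x] are those of a polynomial in
   [Q = q - q(x)]. *)
Lemma mev_foldr_mderivX (Q : mpoly N R) n w x :
  (forall i, mderiv i Q = mpolyX R (mnm1 i)) -> mev x Q = 0 ->
  mev x (foldr (@mderiv N R) (Q ^+ n) w) = n`!%:R * mev x (jetpoly w n).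
Proof.
move=> dQ Q0; rewrite foldr_mderivX // /mev raddf_sum.
transitivity (\sum_(m < (size w).+1) if n == m then n`!%:R * mev x (jetpoly w n) else 0).
  apply: eq_bigr => m _; rewrite /= mevalMn mevalM rmorphXn /= -/(mev x Q) Q0 expr0n subn_eq0.
  case: (ltngtP n m) => [nm|mn|<-]; rewrite ?mul0r ?mul0rn //.
    by rewrite ffact_small.
  by rewrite ffactnn mul1r mulr_natl.
case: (ltnP (size w) n) => nw.
  rewrite -/(mev x _) jetpoly_oversize // /mev meval0 mulr0 big1 // => m _.
  by rewrite if_same.
rewrite (bigD1 (Ordinal (nw : (n < (size w).+1)%N))) //= eqxx big1 ?addr0 // => m.
by rewrite -val_eqE /= eq_sym => /negPf->.
Qed.

End Analysis.

Arguments mev {R N}.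
Arguments jetpoly {R N}.
Arguments sqn {R N}.

(** * The squared norm of the k-th gradient of a radial function *)

Section RadialFormula.
Variables (R : realType) (N : nat).
Implicit Types (x z : 'rV[R]_N).

Lemma enorm_sqn x : enorm x = Num.sqrt (sqn x).
Proof. by []. Qed.

Lemma enorm_gt0 x : x != 0 -> 0 < enorm x.
Proof. by move=> x0; rewrite enorm_sqn sqrtr_gt0 sqn_gt0. Qed.

Lemma sqr_enorm x : enorm x ^+ 2 = sqn x.
Proof. by rewrite enorm_sqn sqr_sqrtr // sumr_ge0 // => j _; exact: sqr_ge0. Qed.

(** At [x] the order-[k] derivatives of [g 0] are those of its Taylor polynomial in [Q], to which
    [pairing_radial] applies with [u] the direction of [x] and [y] the coordinates centred at
    [x]. *)
Lemma gradk_norm_radial (g : nat -> 'rV[R]_N -> R) k x :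
  (forall n z i, z != 0 -> is_derive z (evec R i) (g n) (z ord0 i * g n.+1 z)) ->
  x != 0 ->
  gradk_norm k (g 0) x ^+ 2 = \sum_(l < k./2.+1) mono_norm R N (k - 2 * l) l *
    (\sum_(n < k.+1) (g n x / n`!%:R) * 'C(n, k - n)%:R * 'C(k - n, l)%:R *
       2^-1 ^+ (k - n) * enorm x ^+ (n - (k - n))) ^+ 2.
Proof.
move=> dg x0; have r0 := enorm_gt0 _ x0.
pose A : comAlgType R := mpoly N R.
pose D i : {linear A -> A} := @mderiv N R i.
pose e : {rmorphism A -> R} := meval (fun i => x ord0 i).
pose y i : A := mpolyX R (mnm1 i) - mpolyC N (x ord0 i).
pose u i : R := x ord0 i / enorm x.
have eZ (c : R) (f : A) : e (c *: f) = c * e f by rewrite /e /= mevalZ.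
have DM i (f h : A) : D i (f * h) = D i f * h + f * D i h by exact: mderivM.
have DC i j (f : A) : D i (D j f) = D j (D i f) by exact: mderiv_comm.
have ey i : e (y i) = 0 by rewrite /e /y /= mevalB mevalXU mevalC subrr.
have Dy i j : D i (y j) = (i == j)%:R.
  by rewrite /D /y /= mderivB mderivXU mderivC subr0.
have u1 : \sum_i u i ^+ 2 = 1.
  under eq_bigr => i _ do rewrite /u exprMn exprVn.
  by rewrite -mulr_suml -/(sqn x) -sqr_enorm divff // sqrf_eq0 gt_eqF.
have := @pairing_radial R A N D e y eZ DM DC ey Dy u u1 k (enorm x) (fun n => g n x / n`!%:R).
set Q := (_ *: _ + _) => /= <-.
(* The norm of [x] cancels the normalisation of [u]. The gradient of [Q] then has components
   [x_i + y i], which is the variable [X_i]. *)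
have QE : Q = \sum_i x ord0 i *: y i + 2^-1 *: \sum_i y i ^+ 2.
  congr (_ + _); rewrite scaler_sumr; apply: eq_bigr => i _.
  by rewrite scalerA mulrCA divff ?mulr1 // gt_eqF.
have DQ i : D i Q = mpolyX R (mnm1 i).
  have D1x : D i (\sum_j x ord0 j *: y j) = x ord0 i *: 1.
    rewrite linear_sum (bigD1 i) //= big1 => [|j ji].
      by rewrite linearZ /= Dy eqxx addr0.
    by rewrite linearZ /= Dy eq_sym (negPf ji) scaler0.
  have D2y : D i (\sum_j y j ^+ 2) = 2 *: y i.
    rewrite linear_sum (bigD1 i) //= big1 => [|j ji].
      by rewrite expr2 DM Dy eqxx mul1r mulr1 addr0 -mulr2n scaler_nat.
    by rewrite expr2 DM Dy eq_sym (negPf ji) mul0r mulr0 addr0.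
  rewrite QE linearD linearZ /= D1x D2y scalerA mulVf ?pnatr_eq0 // scale1r /y.
  by rewrite -mul_mpolyC mulr1 addrC subrK.
have Q0 : mev x Q = 0.
  rewrite QE /mev -/e rmorphD eZ !raddf_sum !big1 ?mulr0 ?addr0 // => i _ /=.
    by rewrite expr2 mevalM -/(e (y i)) ey mul0r.
  by rewrite mevalZ -/(e (y i)) ey mulr0.
rewrite pairing_tuple // /gradk_norm sqr_sqrtr; last first.
  by apply: sumr_ge0 => t _; exact: sqr_ge0.
apply: eq_bigr => t _; rewrite -expr2; congr (_ ^+ 2).
rewrite pdiff_jetpoly // size_tuple.
have -> : foldr D (\sum_(n < k.+1) (g n x / n`!%:R) *: Q ^+ n) t =
  \sum_(n < k.+1) (g n x / n`!%:R) *: foldr (@mderiv N R) (Q ^+ n) t.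
  elim: (tval t) => //= i w ->; rewrite linear_sum; apply: eq_bigr => n _.
  by rewrite linearZ.
rewrite raddf_sum; apply: eq_bigr => n _; rewrite /= eZ.
rewrite -[e _]/(mev x _) mev_foldr_mderivX //.
by rewrite mulrA divfK // pnatr_eq0 -lt0n fact_gt0.
Qed.

Lemma rbinom_nat n m : rbinom (n%:R : R) m = 'C(n, m)%:R.
Proof.
have ffactE : ffact (n%:R : R) m = (n ^_ m)%:R.
  rewrite ffact_prod natr_prod; case: (leqP m n) => [mn|nm].
    by apply: eq_bigr => i _; rewrite natrB // ltnW // (leq_trans (ltn_ord i)).
  rewrite /ffact (bigD1 (Ordinal nm)) //= subrr mul0r.
  by rewrite (bigD1 (Ordinal nm)) //= subnn mul0r.
rewrite /rbinom ffactE -bin_ffact natrM mulfK // pnatr_eq0 -lt0n; exact: fact_gt0.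
Qed.

(** Each factor [2j (2j + N - 3)] equals [4 j ((N - 3) / 2 + j)]; the falling factorial lists the
    last brackets in reverse order. *)
Lemma mono_normE k l : (2 * l <= k)%N ->
  mono_norm R N (k - 2 * l) l = k`!%:R * ((k - 2 * l)`!%:R * l`!%:R *
     ffact ((N%:R - 3) / 2 + l%:R) l * (2 ^+ l) ^+ 2).
Proof.
move=> lk; rewrite /mono_norm subnK // -!mulrA; congr (_ * (_ * _)).
rewrite -exprM mulnC exprM.
have -> : (2 ^+ 2) ^+ l = \prod_(j < l) (4 : R).
  by rewrite prodr_const card_ord; congr (_ ^+ _); ring.
have -> : l`!%:R = \prod_(j < l) (j.+1%:R : R).
  by rewrite fact_prod big_add1 big_mkord natr_prod.
have -> : ffact ((N%:R - 3) / 2 + l%:R) l = \prod_(j < l) ((N%:R - 3) / 2 + j.+1%:R) :> R.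
  rewrite /ffact (reindex_inj rev_ord_inj); apply: eq_bigr => j _ /=.
  by rewrite natrB // -addrA opprB [l%:R + _]addrC subrK.
by rewrite -!big_split; apply: eq_bigr => j _ /=; rewrite natrM; field.
Qed.

(** [rho] absorbs the factor independent of [n]: the power of the norm in (i), a sign in (ii). The
    shape of [g n x] is required only where ['C(n, k - n)] can be nonzero, which keeps the logarithm
    itself out of (ii). *)
Lemma radial_formula (g : nat -> 'rV[R]_N -> R) (b : nat -> R) (rho : R) k x :
  (forall n z i, z != 0 -> is_derive z (evec R i) (g n) (z ord0 i * g n.+1 z)) ->
  x != 0 ->
  (forall n, (uphalf k <= n <= k)%N ->
     g n x = 2 ^+ n * n`!%:R * b n * rho / enorm x ^+ (2 * n)) ->
  (enorm x ^+ k * gradk_norm k (g 0) x) ^+ 2 =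
  rho ^+ 2 * ((k`!)%:R * \sum_(0 <= l < k./2.+1)
     ((k - 2 * l)`!)%:R * (l`!)%:R * ffact ((N%:R - 3) / 2 + l%:R) l *
     (\sum_(uphalf k <= n < (k - l).+1)
        (2 ^ (2 * n + l - k))%:R * b n
          * rbinom n%:R (k - n) * rbinom (k - n)%:R l) ^+ 2).
Proof.
move=> dg x0 gE; have r0 : enorm x != 0 by rewrite gt_eqF // enorm_gt0.
rewrite exprMn gradk_norm_radial // big_mkord !mulr_sumr; apply: eq_bigr => -[l lk] _ /=.
have {}lk : (2 * l <= k)%N by move: lk; lia.
rewrite mono_normE //.
set S := \sum_(n < _) _; set T := \sum_(_ <= n < _) _.
(* All powers of the norm combine to [enorm x ^- k], whatever [n]. The [2 ^+ l] cancels against the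
   one in [mono_normE]. *)
suff ST : S = rho / (2 ^+ l * enorm x ^+ k) * T.
  by rewrite ST; field; rewrite ?expf_neq0 // pnatr_eq0.
rewrite /S /T -(big_mkord xpredT (fun n => (g n x / n`!%:R) * 'C(n, k - n)%:R *
  'C(k - n, l)%:R * 2^-1 ^+ (k - n) * enorm x ^+ (n - (k - n)))).
(* Terms with [n < k - n] or [k - n < l] are dropped, their binomials being zero. *)
rewrite (@big_cat_nat _ _ _ (uphalf k)) //=; last by lia.
rewrite big_nat_cond big1 ?add0r => [|n]; last first.
  by move=> nk; rewrite bin_small ?mulr0 ?mul0r //; lia.
rewrite (@big_cat_nat _ _ _ (k - l).+1) //=; [|by lia|by lia].
rewrite [X in _ + X]big_nat_cond [X in _ + X]big1 ?addr0 => [|n]; last first.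
  by move=> nk; rewrite (@bin_small (k - n)) ?mulr0 ?mul0r //; lia.
rewrite mulr_sumr; apply: eq_big_nat => n nk.
have nk1 : (uphalf k <= n <= k)%N by lia.
rewrite !rbinom_nat (gE n nk1) natrX.
have -> : enorm x ^+ (2 * n) = enorm x ^+ k * enorm x ^+ (n - (k - n)).
  by rewrite -exprD; congr (_ ^+ _); lia.
have -> : (2 ^+ (2 * n + l - k) : R) = 2 ^+ n * 2 ^+ l / 2 ^+ (k - n).
  rewrite -exprD; apply: (canRL (mulfK _)); first by rewrite expf_neq0 // pnatr_eq0.
  by rewrite -exprD; congr (_ ^+ _); lia.
rewrite exprVn; field.
by rewrite ?expf_neq0 ?pnatr_eq0 ?r0 -?lt0n ?fact_gt0.
Qed.

End RadialFormula.

(** * Powers and logarithm of the norm *)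

Section PowersOfNorm.
Variables (R : realType) (N : nat).
Implicit Types z : 'rV[R]_N.

Lemma sqn_ge0 z : 0 <= sqn z.
Proof. by apply: sumr_ge0 => j _; exact: sqr_ge0. Qed.

Lemma powR_enorm z s : enorm z `^ s = sqn z `^ (s / 2).
Proof. by rewrite enorm_sqn -powR12_sqrt ?sqn_ge0 // -powRrM mulrC. Qed.

Lemma ln_enorm z : ln (enorm z) = 2^-1 * ln (sqn z).
Proof. by rewrite enorm_sqn -powR12_sqrt ?sqn_ge0 // ln_powR. Qed.

(* [pow_jet s n] and [ln_jet n] are the [n]-th derivatives of [|z|^s] and [ln |z|]
   with respect to [|z|^2 / 2]. *)
Definition pow_jet (s : R) (n : nat) z : R :=
  2 ^+ n * ffact (s / 2) n * sqn z `^ (s / 2 - n%:R).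

Lemma pow_jet0 s : pow_jet s 0 = fun z => enorm z `^ s.
Proof.
by apply/funext => z; rewrite powR_enorm /pow_jet /ffact big_ord0 !mul1r subr0.
Qed.

Lemma is_derive_pow_jet s n z i : z != 0 ->
  is_derive z (evec R i) (pow_jet s n) (z ord0 i * pow_jet s n.+1 z).
Proof.
move=> z0; have q0 := sqn_gt0 _ _ _ z0.
pose c := 2 ^+ n * ffact (s / 2) n.
have dphi := is_deriveZ c (is_derive1_powR (s / 2 - n%:R) q0).
have := is_derive_sqn _ _ _ i _ _ dphi.
rewrite [X in is_derive _ _ _ X](_ : _ = z ord0 i * pow_jet s n.+1 z) //.
rewrite /pow_jet /c /ffact big_ord_recr -[n.+1%:R]natr1 opprD addrA exprS -[_ *: _]/(_ * _) /=.
ring.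
Qed.

Lemma pow_jetE s n z : z != 0 ->
  pow_jet s n z = 2 ^+ n * n`!%:R * rbinom (s / 2) n * enorm z `^ s / enorm z ^+ (2 * n).
Proof.
move=> z0; have q0 := sqn_gt0 _ _ _ z0.
rewrite exprM sqr_enorm powR_enorm /pow_jet /rbinom.
rewrite powRD; last by apply/implyP => _; rewrite gt_eqF.
rewrite powRN powR_mulrn ?sqn_ge0 //; field.
by rewrite expf_neq0 ?gt_eqF // ltr0n fact_gt0.
Qed.

Definition ln_jet (n : nat) z : R :=
  if n is m.+1 then (- 2) ^+ m * m`!%:R / sqn z ^+ m.+1 else ln (enorm z).

Lemma is_derive_ln_jet n z i : z != 0 ->
  is_derive z (evec R i) (ln_jet n) (z ord0 i * ln_jet n.+1 z).
Proof.
move=> z0; have q0 := sqn_gt0 _ _ _ z0; have q1 : sqn z != 0 by rewrite gt_eqF.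
case: n => [|n].
  have dphi := is_deriveZ 2^-1 (is_derive1_ln q0).
  have := is_derive_sqn _ _ _ i _ _ dphi.
  rewrite (_ : _ \o _ = ln_jet 0); last by apply/funext => w; rewrite /= ln_enorm.
  rewrite [X in is_derive _ _ _ X](_ : _ = z ord0 i * ln_jet 1 z) //.
  by rewrite /ln_jet -[_ *: _]/(_ * _) expr0 fact0 expr1; field.
have dphi := is_deriveZ ((- 2) ^+ n * n`!%:R)
  (is_deriveX n.+1 (@is_deriveV _ id (sqn z) 1 1 q1 (is_derive_id _ _))).
have := is_derive_sqn _ _ _ i _ _ dphi.
rewrite (_ : _ \o _ = ln_jet n.+1); last first.
  by apply/funext => w; rewrite /= !fctE exprVn.
rewrite [X in is_derive _ _ _ X](_ : _ = z ord0 i * ln_jet n.+2 z) //.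
rewrite /ln_jet -![_ *: _]/(_ * _) factS natrM [(-2) ^+ n.+1]exprS !exprS /= !expr0 exprVn.
by field; rewrite q1 expf_neq0.
Qed.

(** The shape required by [radial_formula], with [rho = -1]. Order 0 is excluded, as the logarithm
    is not a multiple of a power of the norm. *)
Lemma ln_jetE n z : (0 < n)%N -> z != 0 ->
  ln_jet n z = 2 ^+ n * n`!%:R * ((-1) ^+ n / (2 * n)%:R) * (-1) / enorm z ^+ (2 * n).
Proof.
move=> n0 z0; have q0 := sqn_gt0 _ _ _ z0.
rewrite exprM sqr_enorm; case: n n0 => // n _.
rewrite /ln_jet -mulN1r exprMn factS !natrM !exprS; field.
by rewrite expf_neq0 ?gt_eqF // ltr0n.
Qed.

End PowersOfNorm.

Theorem theorem1p2 (R : realType) (N : nat) (hN : (0 < N)%N) :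
  (forall (k : nat) (s : R) (x : 'rV[R]_N), x != 0 ->
     gamma_fun s k x = @gamma_formula R N s k) /\
  (forall (k : nat), (0 < k)%N -> forall x : 'rV[R]_N, x != 0 ->
     ell_fun k x = @ell_formula R N k).
Proof.
split=> [k s x x0|k k0 x x0].
  have r0 := enorm_gt0 _ _ _ x0.
  rewrite /gamma_fun -(@pow_jet0 R N s) powRD; last by apply/implyP => _; rewrite gt_eqF.
  rewrite powRN powR_mulrn ?ltW // mulrAC exprMn.
  rewrite (@radial_formula R N (@pow_jet R N s) (rbinom (s / 2)) (enorm x `^ s) k x
    (@is_derive_pow_jet R N s) x0 (fun n _ => pow_jetE R N s n x x0)).
  (* The square of [rho], here [enorm x] to the power [s], cancels the weight of exponent [- s]. *)
  by rewrite mulrAC -exprMn divff ?expr1n ?mul1r // gt_eqF // powR_gt0.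
(* Since [k] is positive, so is [uphalf k], and [ln_jetE] covers every [n] in the range. *)
have jetE n : (uphalf k <= n <= k)%N -> _ :=
  fun nk => ln_jetE R N n x (ltac:(lia)) x0.
rewrite /ell_fun (@radial_formula R N (@ln_jet R N) _ (-1) k x
  (@is_derive_ln_jet R N) x0 jetE).
by rewrite sqrrN expr1n mul1r.
Qed.
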